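(* Let $\theta\in\mathbb{R}^{n_\theta}$ and suppose $\phi=(\bar x,\bar\lambda,\bar\nu)\in\Phi(\theta)$ satisfies the SSOSC, LICQ and SCS for $P_1(\theta)$. Let $\bar\xi=(\bar x,\bar z,\bar\mu)\in\Xi(\theta)$ be the associated point, with $\bar z_i=\sqrt{-2g_{\theta,i}(\bar x)}$ and $\bar\mu=(\bar\lambda,\bar\nu)$. Then there is a constant $L(\theta,\bar\xi)>0$, independent of $\rho$, such that for all $\rho>0$ small enough $$\frac{\|\nabla_\theta x(\theta)-\bar\nabla^\rho_\theta x(\theta;\bar\xi)\|_\infty}{\|\nabla_\theta x(\theta)\|_\infty}\le L(\theta,\bar\xi)\,\rho.$$
   Context: Problem. For a parameter $\theta\in\mathbb{R}^{n_\theta}$, $P_1(\theta)$ is the problem of minimizing $f_\theta(x)$ over $x\in\mathbb{R}^{n_x}$ subject to $g_\theta(x)\le 0$ and $h_\theta(x)=0$, where $f_\theta:\mathbb{R}^{n_x}\to\mathbb{R}$, $g_\theta:\mathbb{R}^{n_x}\to\mathbb{R}^{n_{\rm in}}$, $h_\theta:\mathbb{R}^{n_x}\to\mathbb{R}^{n_{\rm eq}}$ are twice continuously differentiable for all $\theta$, and $\nabla_x f_\theta,\nabla_x g_\theta,\nabla_x h_\theta$ are continuously differentiable in $\theta$. Let $X(\theta)$ be the set of local minimizers of $P_1(\theta)$, and $$\bar{\mathcal L}_\theta(x,\lambda,\nu)=f_\theta(x)+\sum_{i=1}^{n_{\rm in}}\lambda_i g_{\theta,i}(x)+\sum_{j=1}^{n_{\rm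 eq}}\nu_j h_{\theta,j}(x).$$ $\Phi(\theta)$ is the set of all $\phi=(x,\lambda,\nu)$ with $x\in X(\theta)$ satisfying the KKT conditions $\nabla_x\bar{\mathcal L}_\theta(x,\lambda,\nu)=0$, $g_\theta(x)\le 0$, $h_\theta(x)=0$, $\lambda_i g_{\theta,i}(x)=0$ and $\lambda_i\ge 0$ for all $i$. $\Xi(\theta)=\{(x,z,\mu):\mu=(\lambda,\nu),\ (x,\lambda,\nu)\in\Phi(\theta),\ z_i=\sqrt{-2g_{\theta,i}(x)}\}$. $\mathcal I=\mathcal I(x)$ is the set of indices $i\in\{1,\dots,n_{\rm in}\}$ with $g_{\theta,i}(x)=0$, $\bar{\mathcal I}$ is its complement, and $g_{\theta,\mathcal I}$, $g_{\theta,\bar{\mathcal I}}$ stack the corresponding components of $g_\theta$. $\nabla_x g$, $\nabla_\theta g$ etc. denote Jacobians of vector-valued functions (one row per component), and $\nabla^2_{\theta x}\bar{\mathcal L}_\theta$ is the $n_x\times n_\theta$ Jacobian with respect to $\theta$ of $\nabla_x\bar{\mathcal L}_\theta$. Conditions at $\phi=(x,\lambda,\nu)\in\Phi(\theta)$. SSOSC: $y^\top\nabla_x^2\bar{\mathcal L}_\theta(\phi)y>0$ for all $y\neq 0$ in $\mathbb{R}^{n_x}$ with $\nabla_x h_\theta(x)y=0$ and $\nabla_x g_{\theta,i}(x)y=0$ for all $i\in\mathcal I(x)$ with $\lambda_i>0$. LICQ: the matrix obtained by stacking $\nabla_x g_{\theta,\mathcal I}(x)$ and $\nabla_x h_\theta(x)$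 has full row rank. SCS: $\lambda_i>0$ for all $i\in\mathcal I(x)$. Derivative. Under SSOSC, LICQ and SCS at $\phi$ there is a neighborhood $N$ of $\theta$ and a continuously differentiable map $\tilde\theta\mapsto\phi(\tilde\theta)=(x(\tilde\theta),\lambda(\tilde\theta),\nu(\tilde\theta))\in\Phi(\tilde\theta)$ on $N$ with $\phi(\theta)=\phi$; $\nabla_\theta x(\theta)$ is the Jacobian of its $x$-component at $\theta$, which equals the first $n_x$ rows of the unique solution $V$ of $A_\theta(\phi)V=-b_\theta(\phi)$, where $$A_\theta(\phi)=\begin{bmatrix}\nabla_x^2\bar{\mathcal L}_\theta(\phi)&\nabla_x g_{\theta,\mathcal I}(\bar x)^\top&\nabla_x h_\theta(\bar x)^\top\\ \nabla_x g_{\theta,\mathcal I}(\bar x)&0&0\\ \nabla_x h_\theta(\bar x)&0&0\end{bmatrix},\qquad b_\theta(\phi)=\begin{bmatrix}\nabla^2_{\theta x}\bar{\mathcal L}_\theta(\phi)\\ \nabla_\theta g_{\theta,\mathcal I}(\bar x)\\ \nabla_\theta h_\theta(\bar x)\end{bmatrix}.$$ Surrogate derivative. For $\rho>0$ sufficiently small, $\bar\nabla^\rho_\theta x(\theta;\bar\xi)$ denotes the first $n_x$ rows of the unique solution $V$ of $[A_\theta(\phi)+B^\rho_\theta(\bar\xi)]V=-(b_\theta(\phi)+d^\rho_\theta(\bar\xi))$, where $$B^\rho_\theta(\bar\xi)=\begin{bmatrix}H+\rho I&0&0\\0&-\rho I&0\\0&0&-\rho I\end{bmatrix},\qquad d^\rho_\theta(\bar\xi)=\begin{bmatrix}l\\0\\0\end{bmatrix},$$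 $$H=\nabla_x g_{\theta,\bar{\mathcal I}}(\bar x)^\top\operatorname{diag}\!\left(\frac{\rho}{\bar z_i^2+\rho^2}\right)_{i\in\bar{\mathcal I}}\nabla_x g_{\theta,\bar{\mathcal I}}(\bar x),\qquad l=\nabla_x g_{\theta,\bar{\mathcal I}}(\bar x)^\top\operatorname{diag}\!\left(\frac{\rho}{\bar z_i^2+\rho^2}\right)_{i\in\bar{\mathcal I}}\nabla_\theta g_{\theta,\bar{\mathcal I}}(\bar x).$$ $\|\cdot\|_\infty$ is the matrix norm induced by the vector $\infty$-norm.
   Formalization: The gradients of f, g, h in x are assumed continuously differentiable jointly in (θ,x), and g, h themselves jointly continuously differentiable; with smoothness only separately in x and θ the claim fails. *)

(* Defs.v *)
From HB Require Import structures.
From mathcomp Require Import all_boot all_order all_algebra.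
From mathcomp Require Import all_classical all_reals all_analysis.
Set Implicit Arguments.
Unset Strict Implicit.
Unset Printing Implicit Defensive.
Import Order.TTheory GRing.Theory Num.Theory.
Import numFieldNormedType.Exports.
Local Open Scope classical_set_scope.
Local Open Scope ring_scope.

Section Calculus.
Context {R : realType}.

Definition grad n (F : 'cV[R]_n -> R) (x : 'cV[R]_n) : 'cV[R]_n :=
  \col_j 'D_(delta_mx j 0) F x.

(* One row per component of [F]: the transpose of the layout of the library's
   ['J], which is restricted to row vectors. *)
Definition jac n m (F : 'cV[R]_n -> 'cV[R]_m) (x : 'cV[R]_n) : 'M[R]_(m, n) :=
  \matrix_(i, j) 'D_(delta_mx j 0) (fun y => F y i 0) x.

Definition hess n (F : 'cV[R]_n -> R) (x : 'cV[R]_n) : 'M[R]_n :=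
  jac (grad F) x.

(* The domains used below are all finite-dimensional, so continuity of the
   differential is the same as its continuity along every fixed vector. *)
Definition C1_on (U V : normedModType R) (A : set U) (F : U -> V) : Prop :=
  forall p, A p -> differentiable F p /\
    forall v, {for p, continuous (fun q => 'd F q v)}.

(* The norm of ['cV[R]_n] in the library is the max norm, so this is the
   matrix norm induced by the vector infinity-norm. *)
Definition norm_inf m n (M : 'M[R]_(m, n)) : R :=
  sup [set `|M *m v| | v in [set v : 'cV[R]_n | `|v| <= 1]].

Definition rows m n (I : {set 'I_m}) (M : 'M[R]_(m, n)) : 'M[R]_(#|I|, n) :=
  rowsub (fun k : 'I_#|I| => enum_val k) M.

End Calculus.

Section ParametricProgram.
Context {R : realType} {nt nx nin neq : nat}.

Variables (f : 'cV[R]_nt -> 'cV[R]_nx -> R)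
          (g : 'cV[R]_nt -> 'cV[R]_nx -> 'cV[R]_nin)
          (h : 'cV[R]_nt -> 'cV[R]_nx -> 'cV[R]_neq).

(* Differentiability in the parameter is joint in (theta, x).  Separate
   differentiability would not give the formula for the derivative of a
   solution: with f_theta' (x) = x - 2 x theta^2 / (x^2 + theta^2) the local
   minimizer x = theta has derivative 1 at 0, although the second derivatives
   xx and theta x of f at the origin are 1 and 0.  The constraints themselves
   are included because their Jacobians in theta are used below. *)
Definition regular : Prop :=
  (forall t, [/\ C1_on setT (f t), C1_on setT (g t) & C1_on setT (h t)]) /\
  (forall t, [/\ C1_on setT (grad (f t)), C1_on setT (jac (g t))
               & C1_on setT (jac (h t))]) /\
  [/\ C1_on setT (fun p : 'cV[R]_nt * 'cV[R]_nx => grad (f p.1) p.2),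
      C1_on setT (fun p : 'cV[R]_nt * 'cV[R]_nx => jac (g p.1) p.2)
    & C1_on setT (fun p : 'cV[R]_nt * 'cV[R]_nx => jac (h p.1) p.2)] /\
  C1_on setT (fun p : 'cV[R]_nt * 'cV[R]_nx => g p.1 p.2) /\
  C1_on setT (fun p : 'cV[R]_nt * 'cV[R]_nx => h p.1 p.2).

Definition feasible (t : 'cV[R]_nt) (x : 'cV[R]_nx) : Prop :=
  (forall i, g t x i 0 <= 0) /\ h t x = 0.

Definition local_minimizers (t : 'cV[R]_nt) : set 'cV[R]_nx :=
  [set x | feasible t x /\ \forall y \near x, feasible t y -> f t x <= f t y].

Definition lagrangian (t : 'cV[R]_nt) (lam : 'cV[R]_nin) (nu : 'cV[R]_neq)
    (x : 'cV[R]_nx) : R :=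
  f t x + \sum_i lam i 0 * g t x i 0 + \sum_j nu j 0 * h t x j 0.

Definition Phi (t : 'cV[R]_nt) : set ('cV[R]_nx * 'cV[R]_nin * 'cV[R]_neq) :=
  [set p | let: (x, lam, nu) := p in
    local_minimizers t x /\
    [/\ grad (lagrangian t lam nu) x = 0,
        feasible t x,
        forall i, lam i 0 * g t x i 0 = 0
      & forall i, 0 <= lam i 0]].

Definition Xi (t : 'cV[R]_nt) :
    set ('cV[R]_nx * 'cV[R]_nin * ('cV[R]_nin * 'cV[R]_neq)) :=
  [set p : 'cV[R]_nx * 'cV[R]_nin * ('cV[R]_nin * 'cV[R]_neq) |
    let: (x, z, mu) := p in
    Phi t (x, mu.1, mu.2) /\
    forall i, z i 0 = Num.sqrt (- (2 * g t x i 0))].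

Definition active (t : 'cV[R]_nt) (x : 'cV[R]_nx) : {set 'I_nin} :=
  finset (fun i => g t x i 0 == 0).

Definition inactive (t : 'cV[R]_nt) (x : 'cV[R]_nx) : {set 'I_nin} :=
  finset.setC (active t x).

Definition SSOSC (t : 'cV[R]_nt) (x : 'cV[R]_nx) (lam : 'cV[R]_nin)
    (nu : 'cV[R]_neq) : Prop :=
  forall y : 'cV[R]_nx, y != 0 ->
    jac (h t) x *m y = 0 ->
    (forall i, i \in active t x -> 0 < lam i 0 ->
       row i (jac (g t) x) *m y = 0) ->
    0 < (y^T *m hess (lagrangian t lam nu) x *m y) 0 0.

Definition LICQ (t : 'cV[R]_nt) (x : 'cV[R]_nx) : Prop :=
  row_free (col_mx (rows (active t x) (jac (g t) x)) (jac (h t) x)).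

Definition SCS (t : 'cV[R]_nt) (x : 'cV[R]_nx) (lam : 'cV[R]_nin) : Prop :=
  forall i, i \in active t x -> 0 < lam i 0.

(* [J] is the Jacobian at [t] of the x-component of a continuously
   differentiable selection of [Phi] through [p] defined around [t]. *)
Definition is_solution_jac (t : 'cV[R]_nt)
    (p : 'cV[R]_nx * 'cV[R]_nin * 'cV[R]_neq) (J : 'M[R]_(nx, nt)) : Prop :=
  exists (N : set 'cV[R]_nt)
         (phi : 'cV[R]_nt -> 'cV[R]_nx * 'cV[R]_nin * 'cV[R]_neq),
    [/\ open_nbhs t N, C1_on N phi,
        forall s, N s -> Phi s (phi s), phi t = p
      & J = jac (fun s => (phi s).1.1) t].

Section Systems.
Variables (t : 'cV[R]_nt) (x : 'cV[R]_nx) (z : 'cV[R]_nin)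
          (lam : 'cV[R]_nin) (nu : 'cV[R]_neq).

Let I := active t x.
Let Ic := inactive t x.

Definition A_mx : 'M[R]_(nx + (#|I| + neq)) :=
  let G := rows I (jac (g t) x) in
  let H := jac (h t) x in
  block_mx (hess (lagrangian t lam nu) x) (row_mx G^T H^T)
           (col_mx G H)                   0.

Definition b_mx : 'M[R]_(nx + (#|I| + neq), nt) :=
  col_mx (jac (fun s => grad (lagrangian s lam nu) x) t)
    (col_mx (rows I (jac (g^~ x) t)) (jac (h^~ x) t)).

Definition weight_mx (rho : R) : 'M[R]_#|Ic| :=
  diag_mx (\row_k (rho / (z (enum_val k) 0 ^+ 2 + rho ^+ 2))).

Definition B_mx (rho : R) : 'M[R]_(nx + (#|I| + neq)) :=
  let G := rows Ic (jac (g t) x) in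
  block_mx (G^T *m weight_mx rho *m G + rho%:M) 0
           0                                    (- rho)%:M.

Definition d_mx (rho : R) : 'M[R]_(nx + (#|I| + neq), nt) :=
  let G := rows Ic (jac (g t) x) in
  col_mx (G^T *m weight_mx rho *m rows Ic (jac (g^~ x) t)) 0.

(* The surrogate derivative exists only when the linear system has exactly one
   solution, hence a relation. *)
Definition is_surrogate_jac (rho : R) (D : 'M[R]_(nx, nt)) : Prop :=
  exists V : 'M[R]_(nx + (#|I| + neq), nt),
    [/\ (A_mx + B_mx rho) *m V = - (b_mx + d_mx rho),
        forall W, (A_mx + B_mx rho) *m W = - (b_mx + d_mx rho) -> W = V
      & D = usubmx V].

End Systems.

End ParametricProgram.

(* Main.v *)
Require Import Defs.
From HB Require Import structures.
From mathcomp Require Import all_boot all_order all_algebra.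
From mathcomp Require Import all_classical all_reals all_analysis.
From mathcomp Require Import ring lra.
Set Implicit Arguments.
Unset Strict Implicit.
Unset Printing Implicit Defensive.
Import Order.TTheory GRing.Theory Num.Theory.
Import numFieldNormedType.Exports.
Local Open Scope classical_set_scope.
Local Open Scope ring_scope.

(** The derivative and its surrogate are the first block of the solutions of
    two linear systems, [A V = - b] and [(A + B) V' = - (b + d)], and both
    perturbations [B] and [d] are O(rho).  Since [A] is invertible, the
    solutions differ by O(rho).

    The derivative [J] is given as the Jacobian of some C1 selection of KKT
    points, so the system it satisfies is derived by differentiating the KKT
    conditions along the selection ([solution_jac_system]).  Strict
    complementarity makes the active set locally constant: near theta an active
    multiplier stays positive, so its constraint stays equal to 0, and an
    inactive constraint stays negative, so its multiplier stays equal to 0.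
    What remains are the identities grad L = 0, g_I = 0 and h = 0, whose
    derivatives are the three block rows of [A V = - b].

    [A] is invertible by the usual argument for KKT matrices
    ([kkt_matrix_unit]), and the perturbations are O(rho) because the weights
    rho / (z_i^2 + rho^2) are at most rho / z_i^2, where z_i is nonzero for an
    inactive constraint ([surrogate_terms_bound]).  The comparison of the two
    systems is [perturbed_system].

    The constant in the theorem is the one of the absolute error divided by the
    norm of [J].  When [J] is zero, the quotient is zero by the convention on
    division, and the same formula gives a valid constant. *)

(** * Entrywise maximum norm of matrices *)

Lemma mx_norm_leP (R : realType) m n (M : 'M[R]_(m, n)) (c : R) :
  0 <= c -> `|M| <= c <-> forall i j, `|M i j| <= c.
Proof.
move=> c0; rewrite [`|M|]/Num.Def.normr /= mx_normrE; split.
  by move=> /bigmax_leP[_ Mc] i j; exact: (Mc (i, j)).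
by move=> Mc; apply/bigmax_leP; split=> // -[i j] _; exact: Mc.
Qed.

Lemma entry_le_norm (R : realType) m n (M : 'M[R]_(m, n)) i j :
  `|M i j| <= `|M|.
Proof. exact: (mx_norm_leP M (normr_ge0 M)).1. Qed.

Lemma norm_mulmx_le (R : realType) m n p (M : 'M[R]_(m, n)) (N : 'M[R]_(n, p)) :
  `|M *m N| <= n%:R * `|M| * `|N|.
Proof.
apply/mx_norm_leP; first by rewrite !mulr_ge0.
move=> i j; rewrite mxE (le_trans (ler_norm_sum _ _ _))//.
have -> : n%:R * `|M| * `|N| = \sum_(k < n) `|M| * `|N|.
  by rewrite sumr_const card_ord -mulrA mulr_natl.
apply: ler_sum => k _; by rewrite normrM ler_pM// entry_le_norm.
Qed.

Lemma norm_sandwich_le (R : realType) m n p (X : 'M[R]_(m, n)) (W : 'M[R]_n)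
    (Y : 'M[R]_(n, p)) :
  `|X *m W *m Y| <= n%:R ^+ 2 * `|X| * `|Y| * `|W|.
Proof.
rewrite (le_trans (norm_mulmx_le _ _))//.
apply: (@le_trans _ _ (n%:R * (n%:R * `|X| * `|W|) * `|Y|)).
  by rewrite ler_wpM2r// ler_wpM2l// norm_mulmx_le.
by rewrite le_eqVlt; apply/orP; left; apply/eqP; ring.
Qed.

Lemma norm_block_mx_le (R : realType) m1 m2 n1 n2 (M11 : 'M[R]_(m1, n1))
    (M12 : 'M[R]_(m1, n2)) (M21 : 'M[R]_(m2, n1)) (M22 : 'M[R]_(m2, n2)) :
  `|block_mx M11 M12 M21 M22| <= `|M11| + `|M12| + `|M21| + `|M22|.
Proof.
apply/mx_norm_leP => [|i j]; first by rewrite !addr_ge0.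
have := (normr_ge0 M11, normr_ge0 M12, normr_ge0 M21, normr_ge0 M22).
move=> [[[? ?] ?] ?]; rewrite -[i]splitK -[j]splitK.
case: (fintype.split i) => k; case: (fintype.split j) => l /=;
  rewrite ?block_mxEul ?block_mxEur ?block_mxEdl ?block_mxEdr;
  by rewrite (le_trans (entry_le_norm _ _ _)) //; lra.
Qed.

Lemma norm_col_mx_le (R : realType) m1 m2 n (M1 : 'M[R]_(m1, n))
    (M2 : 'M[R]_(m2, n)) :
  `|col_mx M1 M2| <= `|M1| + `|M2|.
Proof.
apply/mx_norm_leP => [|i j]; first by rewrite !addr_ge0.
have := (normr_ge0 M1, normr_ge0 M2) => -[? ?].
rewrite -[i]splitK.
case: (fintype.split i) => k /=; rewrite ?col_mxEu ?col_mxEd;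
  by rewrite (le_trans (entry_le_norm _ _ _)) //; lra.
Qed.

Lemma norm_usubmx_le (R : realType) m1 m2 n (M : 'M[R]_(m1 + m2, n)) :
  `|usubmx M| <= `|M|.
Proof. by apply/mx_norm_leP => // i j; rewrite mxE entry_le_norm. Qed.

Lemma norm_scalar_mx_le (R : realType) n (a : R) :
  `|a%:M : 'M[R]_n| <= `|a|.
Proof.
by apply/mx_norm_leP => // i j; rewrite mxE; case: eqP; rewrite ?normr0.
Qed.

(** The lower bound and the use of the upper bound both rest on the set of the
    [`|M *m v|] being bounded: without that its [sup] would be a default value. *)
Lemma norm_inf_bounds (R : realType) m n (M : 'M[R]_(m, n)) :
  0 <= norm_inf M <= n%:R * `|M|.
Proof.
have ubM : ubound [set `|M *m v| | v in [set v : 'cV[R]_n | `|v| <= 1]]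
    (n%:R * `|M|).
  move=> _ [v /= v1 <-]; rewrite (le_trans (norm_mulmx_le _ _))//.
  by rewrite -[leRHS]mulr1 ler_wpM2l// mulr_ge0.
have M0 : [set `|M *m v| | v in [set v : 'cV[R]_n | `|v| <= 1]] 0.
  by exists 0 => /=; rewrite ?mulmx0 ?normr0.
apply/andP; split; last by apply: ge_sup => //; exists 0.
by apply: ub_le_sup => //; exists (n%:R * `|M|).
Qed.

(** * Perturbation of linear systems *)

(** An invertible matrix stays away from 0 on large arguments. Unlike
    invertibility itself, this bound visibly survives a small perturbation. *)
Lemma unitmx_bounded_below (R : realType) n (M : 'M[R]_n) : M \in unitmx ->
  exists2 c, 0 < c & forall p (W : 'M[R]_(n, p)), `|W| <= c * `|M *m W|.
Proof.
move=> Mu; exists (n%:R * `|invmx M| + 1) => [|p W].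
  by rewrite ltr_pwDr// mulr_ge0.
rewrite mulrDl mul1r ler_wpDr// -{1}(mulKmx Mu W).
exact: norm_mulmx_le.
Qed.

Lemma inj_unitmx (F : fieldType) n (M : 'M[F]_n) :
  (forall v : 'cV_n, M *m v = 0 -> v = 0) -> M \in unitmx.
Proof.
move=> Minj; rewrite -unitmx_tr -row_free_unit -kermx_eq0.
apply/eqP/row_matrixP => i; rewrite row0; apply: trmx_inj; rewrite trmx0.
by apply: Minj; rewrite -{1}[M]trmxK -trmx_mul -row_mul mulmx_ker row0 trmx0.
Qed.

(** Halving the lower bound of [M] leaves room for [E], which gives both the
    invertibility of [M + E] and, applied to [V - W], the error estimate, because
    [(M + E) (V - W) = e + E V] is O(rho). *)
Lemma perturbed_system (R : realType) n p (M : 'M[R]_n) (b V : 'M[R]_(n, p))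
    (E : R -> 'M[R]_n) (e : R -> 'M[R]_(n, p)) (K : R) :
  M \in unitmx -> M *m V = - b ->
  (\forall rho \near 0^'+, `|E rho| <= K * rho) ->
  (\forall rho \near 0^'+, `|e rho| <= K * rho) ->
  exists2 C, 0 <= C & \forall rho \near 0^'+, M + E rho \in unitmx /\
    forall W, (M + E rho) *m W = - (b + e rho) -> `|V - W| <= C * rho.
Proof.
move=> Mu MV Ebnd ebnd.
have [c c0 Mc] := unitmx_bounded_below Mu.
(* Half of the lower bound of [M] absorbs [E rho]. *)
have lower rho : `|E rho| <= K * rho -> n%:R * K * rho <= (2 * c)^-1 ->
    forall q (W : 'M[R]_(n, q)), `|W| <= 2 * c * `|(M + E rho) *m W|.
  move=> Erho small q W.
  have MW : `|M *m W| <= `|(M + E rho) *m W| + (2 * c)^-1 * `|W|.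
    have -> : M *m W = (M + E rho) *m W - E rho *m W by rewrite mulmxDl addrK.
    rewrite (le_trans (ler_normB _ _))// lerD2l (le_trans (norm_mulmx_le _ _))//.
    rewrite ler_wpM2r// (le_trans _ small)// -[leRHS]mulrA ler_wpM2l//.
  have := le_trans (Mc _ W) (ler_wpM2l (ltW c0) MW).
  rewrite mulrDr mulrA invfM [2^-1 * _]mulrC mulVKf ?gt_eqF//.
  lra.
exists (2 * c * (`|K| + n%:R * `|K| * `|V|)).
  by rewrite !mulr_ge0 ?addr_ge0 ?mulr_ge0// ltW.
near=> rho.
have rho0 : 0 < rho by near: rho; exact: nbhs_right_gt.
have Erho : `|E rho| <= K * rho by near: rho.
have erho : `|e rho| <= K * rho by near: rho.
have small : n%:R * K * rho <= (2 * c)^-1.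
  rewrite (@le_trans _ _ ((n%:R * `|K| + 1) * rho))//.
    by rewrite ler_wpM2r ?(ltW rho0)// ler_wpDr// ler_wpM2l// ler_norm.
  rewrite mulrC -ler_pdivlMr; last by rewrite ltr_pwDr// mulr_ge0.
  near: rho; apply: nbhs_right_le.
  by rewrite divr_gt0 ?invr_gt0 ?ltr_pwDr ?mulr_ge0 ?mulr_gt0.
have low := lower rho Erho small; split.
  apply: inj_unitmx => v Mv0; have := low _ v; rewrite Mv0 normr0 mulr0.
  by rewrite normr_le0 => /eqP.
move=> W MW; rewrite (le_trans (low _ _))//.
have -> : (M + E rho) *m (V - W) = e rho + E rho *m V.
  rewrite mulmxBr MW mulmxDl MV opprK [LHS]addrC addrA; congr (_ + _).
  by rewrite -addrA addrC -addrA addNr addr0.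
rewrite -!mulrA; do 2 rewrite ler_wpM2l ?(ltW c0)//.
have Krho : K * rho <= `|K| * rho by rewrite ler_wpM2r ?(ltW rho0)// ler_norm.
rewrite (le_trans (ler_normD _ _))// mulrDl lerD ?(le_trans erho)//.
rewrite (le_trans (norm_mulmx_le _ _))//.
rewrite (@le_trans _ _ (n%:R * (`|K| * rho) * `|V|))//.
  by rewrite ler_wpM2r// ler_wpM2l// (le_trans Erho).
by rewrite le_eqVlt; apply/orP; left; apply/eqP; ring.
Unshelve. all: by end_near. Qed.

(** * Differentiation along a curve *)

Lemma differentiable_fst_comp (R : realType) (U V W : normedModType R)
    (F : U -> V * W) u :
  differentiable F u -> differentiable (fun s => (F s).1) u.
Proof.
move=> dF; apply: (differentiable_comp (g := fst) dF).
by apply: linear_differentiable => p; exact: cvg_fst.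
Qed.

Lemma differentiable_snd_comp (R : realType) (U V W : normedModType R)
    (F : U -> V * W) u :
  differentiable F u -> differentiable (fun s => (F s).2) u.
Proof.
move=> dF; apply: (differentiable_comp (g := snd) dF).
by apply: linear_differentiable => p; exact: cvg_snd.
Qed.

Lemma differentiable_entry (R : realType) (U : normedModType R) m n
    (F : U -> 'M[R]_(m, n)) u i j :
  differentiable F u -> differentiable (fun v => F v i j) u.
Proof.
move=> dF; apply: (differentiable_comp (g := fun M : 'M[R]_(m, n) => M i j)) => //.
exact: differentiable_coord.
Qed.

Lemma diff_delta_sum (R : realType) n (F : 'cV[R]_n -> R) x v :
  differentiable F x -> 'd F x v = \sum_l 'D_(delta_mx l 0) F x * v l 0.
Proof.
move=> dF; rewrite [v in LHS]matrix_sum_delta linear_sum; apply: eq_bigr => l _.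
by rewrite big_ord1 linearZ deriveE// mulrC.
Qed.

Lemma differentiable_slice1 (R : realType) (U V W : normedModType R)
    (F : U * V -> W) u v :
  differentiable F (u, v) -> differentiable (fun s => F (s, v)) u.
Proof.
move=> dF; apply: (@differentiable_comp _ _ _ _ (fun s => (s, v)) F) => //.
Qed.

Lemma differentiable_slice2 (R : realType) (U V W : normedModType R)
    (F : U * V -> W) u v :
  differentiable F (u, v) -> differentiable (fun y => F (u, y)) v.
Proof.
move=> dF; apply: (@differentiable_comp _ _ _ _ (fun y => (u, y)) F) => //.
Qed.

Lemma diff_slice1 (R : realType) (U V W : normedModType R)
    (F : U * V -> W) u v w :
  differentiable F (u, v) -> 'd (fun s => F (s, v)) u w = 'd F (u, v) (w, 0).
Proof.
move=> dF; have di : is_diff u (fun s : U => (s, v)) (fun w => (w, 0)).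
  exact: (is_diff_pair (is_diff_id u) (is_diff_cst v u)).
by rewrite (diff_comp (@ex_diff _ _ _ _ _ _ _ di) dF) /=
           (@diff_val _ _ _ _ _ _ _ di).
Qed.

Lemma diff_slice2 (R : realType) (U V W : normedModType R)
    (F : U * V -> W) u v w :
  differentiable F (u, v) -> 'd (fun y => F (u, y)) v w = 'd F (u, v) (0, w).
Proof.
move=> dF; have di : is_diff v (fun y : V => (u, y)) (fun w => (0, w)).
  exact: (is_diff_pair (is_diff_cst u v) (is_diff_id v)).
by rewrite (diff_comp (@ex_diff _ _ _ _ _ _ _ di) dF) /=
           (@diff_val _ _ _ _ _ _ _ di).
Qed.

(** The direction [(w, 'd c u w)] of the curve [s |-> (s, c s)] is the sum of a
    direction of [U] and one of [V]. Joint differentiability of [F] is essential: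
    partial derivatives alone do not determine the derivative along the curve. *)
Lemma diff_along_curve (R : realType) (U V W : normedModType R)
    (F : U * V -> W) (c : U -> V) u w :
  differentiable F (u, c u) -> differentiable c u ->
  differentiable (fun s => F (s, c s)) u /\
  'd (fun s => F (s, c s)) u w =
  'd (fun s => F (s, c u)) u w + 'd (fun y => F (u, y)) (c u) ('d c u w).
Proof.
move=> dF dc.
have di : is_diff u (fun s : U => (s, c s)) (fun w => (w, 'd c u w)).
  exact: (is_diff_pair (is_diff_id u) (differentiableP dc)).
have dp := @ex_diff _ _ _ _ _ _ _ di.
split; first exact: (differentiable_comp dp dF).
rewrite (diff_comp dp dF) /= (@diff_val _ _ _ _ _ _ _ di).
rewrite diff_slice1// diff_slice2//.
have -> : (w, 'd c u w) = (w, 0) + (0, 'd c u w).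
  by apply: (f_equal2 pair); rewrite ?addr0 ?add0r.
exact: linearD.
Qed.

(** Differentiability is asked of the components only, which avoids proving it
    for vector-valued combinations. *)
Lemma jac_along_curve (R : realType) k n m (F : 'cV[R]_k * 'cV[R]_n -> 'cV[R]_m)
    (c : 'cV[R]_k -> 'cV[R]_n) t :
  (forall i, differentiable (fun p => F p i 0) (t, c t)) ->
  differentiable c t ->
  jac (fun s => F (s, c s)) t =
  jac (fun s => F (s, c t)) t + jac (fun y => F (t, y)) (c t) *m jac c t.
Proof.
move=> dF dc; apply/matrixP => i j; rewrite !mxE.
have [dFc dFcE] := diff_along_curve (delta_mx j 0) (dF i) dc.
rewrite deriveE// dFcE -deriveE; last exact: (differentiable_slice1 (dF i)).
congr (_ + _).
rewrite diff_delta_sum; last exact: (differentiable_slice2 (dF i)).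
apply: eq_bigr => l _; rewrite !mxE -deriveE//; congr (_ * _).
by rewrite derive_mx ?mxE//; exact: diff_derivable.
Qed.

Lemma derive_pointwise_sum (R : realType) (U : normedModType R) n
    (F : 'I_n -> U -> R) u w :
  (forall i, derivable (F i) u w) ->
  derivable (fun s => \sum_i F i s) u w /\
  'D_w (fun s => \sum_i F i s) u = \sum_i 'D_w (F i) u.
Proof.
move=> dF; have -> : (fun s => \sum_i F i s) = \sum_i F i.
  by apply/funext => s; rewrite fct_sumE.
split; [exact: derivable_sum | exact: derive_sum].
Qed.

Lemma differentiable_trmx_mulmx (R : realType) (U : normedModType R) n m
    (M : U -> 'M[R]_(m, n)) (c : U -> 'cV[R]_m) u i :
  (forall i j, differentiable (fun s => M s i j) u) -> differentiable c u ->
  differentiable (fun s => ((M s)^T *m c s) i 0) u.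
Proof.
move=> dM dc.
have -> : (fun s => ((M s)^T *m c s) i 0) =
    \sum_l ((fun s => M s l i) * (fun s => c s l 0)).
  by apply/funext => s; rewrite fct_sumE mxE; apply: eq_bigr => l _; rewrite mxE.
apply: differentiable_sum => l; apply: differentiableM => //.
exact: differentiable_entry.
Qed.

(** The product rule, arranged so that the first term still has the constant
    multiplier [c t]: this is how the multipliers appear in [A_mx] and [b_mx]. *)
Lemma jac_trmx_mulmx (R : realType) k n m (M : 'cV[R]_k -> 'M[R]_(m, n))
    (c : 'cV[R]_k -> 'cV[R]_m) t :
  (forall i j, differentiable (fun s => M s i j) t) -> differentiable c t ->
  jac (fun s => (M s)^T *m c s) t =
  jac (fun s => (M s)^T *m c t) t + (M t)^T *m jac c t.
Proof.
move=> dM dc; apply/matrixP => i j; rewrite !mxE.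
have dci l : derivable (fun s => c s l 0) t (delta_mx j 0).
  by apply: diff_derivable; exact: differentiable_entry.
have dMi l : derivable (fun s => M s l i) t (delta_mx j 0).
  exact: diff_derivable.
have dMc l : derivable (fun s => M s l i * c s l 0) t (delta_mx j 0).
  exact: derivableM.
have dMct l : derivable (fun s => M s l i * c t l 0) t (delta_mx j 0).
  by apply: derivableM => //; exact: derivable_cst.
have mulE (v : 'cV[R]_k -> 'cV[R]_m) :
    (fun s => ((M s)^T *m v s) i 0) = (fun s => \sum_l M s l i * v s l 0).
  by apply/funext => s; rewrite mxE; apply: eq_bigr => l _; rewrite mxE.
rewrite mulE (mulE (fun=> c t)) (derive_pointwise_sum dMc).2.
rewrite (derive_pointwise_sum dMct).2.
rewrite -big_split; apply: eq_bigr => l _ /=; rewrite !mxE.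
rewrite (deriveM (f := fun s => M s l i) (g := fun s => c s l 0))//.
rewrite deriveMr//; rewrite addrC; congr (_ + _); exact: mulrC.
Qed.

Lemma jacD (R : realType) n m (F G : 'cV[R]_n -> 'cV[R]_m) x :
  (forall i, differentiable (fun y => F y i 0) x) ->
  (forall i, differentiable (fun y => G y i 0) x) ->
  jac (fun y => F y + G y) x = jac F x + jac G x.
Proof.
move=> dF dG; apply/matrixP => i j; rewrite !mxE.
rewrite -deriveD; [|exact: diff_derivable|exact: diff_derivable].
by congr ('D_ _ _ _); apply/funext => y; rewrite mxE.
Qed.

Lemma near_eq_jac (R : realType) n m (F G : 'cV[R]_n -> 'cV[R]_m) x i :
  (\forall y \near x, F y i 0 = G y i 0) -> row i (jac F x) = row i (jac G x).
Proof. by move=> FG; apply/rowP => j; rewrite !mxE; exact: near_eq_derive. Qed.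

Lemma jac_cst (R : realType) n m (c : 'cV[R]_m) (x : 'cV[R]_n) :
  jac (fun=> c) x = 0.
Proof. by apply/matrixP => i j; rewrite !mxE derive_cst. Qed.

(** * The linear system solved by the derivative *)

(** Turns the gradient of the Lagrangian, which is a derivative of a sum, into
    a matrix expression in the data, to which the regularity assumptions apply. *)
Lemma grad_lagrangian (R : realType) (nt nx nin neq : nat)
  (f : 'cV[R]_nt -> 'cV[R]_nx -> R)
  (g : 'cV[R]_nt -> 'cV[R]_nx -> 'cV[R]_nin)
  (h : 'cV[R]_nt -> 'cV[R]_nx -> 'cV[R]_neq) t lam nu x :
  differentiable (f t) x -> differentiable (g t) x -> differentiable (h t) x ->
  grad (lagrangian f g h t lam nu) x =
  grad (f t) x + (jac (g t) x)^T *m lam + (jac (h t) x)^T *m nu.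
Proof.
move=> df dg dh; apply/colP => j; rewrite !mxE.
set e := delta_mx j 0.
have dpart m (F : 'cV[R]_nx -> 'cV[R]_m) (c : 'cV[R]_m) : differentiable F x ->
    derivable (fun y => \sum_i c i 0 * F y i 0) x e /\
    'D_e (fun y => \sum_i c i 0 * F y i 0) x = ((jac F x)^T *m c) j 0.
  move=> dF.
  have dFi i : derivable (fun y => F y i 0) x e.
    by apply: diff_derivable; exact: differentiable_entry.
  have dcF i : derivable (fun y => c i 0 * F y i 0) x e.
    by apply: derivableM => //; exact: derivable_cst.
  have [? ->] := derive_pointwise_sum dcF; split=> //.
  rewrite mxE; apply: eq_bigr => i _; rewrite !mxE deriveMl//; exact: mulrC.
have [dgs dgE] := dpart _ _ lam dg; have [dhs dhE] := dpart _ _ nu dh.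
have dfe : derivable (f t) x e by exact: diff_derivable.
transitivity ('D_e (f t) x + 'D_e (fun y => \sum_i lam i 0 * g t y i 0) x +
  'D_e (fun y => \sum_i nu i 0 * h t y i 0) x); last by rewrite dgE dhE !mxE.
by rewrite -(deriveD dfe dgs) -(deriveD (derivableD dfe dgs) dhs).
Qed.

(** The derivative of the stationarity condition along a curve of primal-dual
    points. The multipliers are frozen first: the product rule splits off their
    derivatives, and what is left is the gradient of a fixed Lagrangian along
    [xs], whose two partial Jacobians are the first blocks of [b_mx] and
    [A_mx]. *)
Lemma jac_stationarity (R : realType) (nt nx nin neq : nat)
  (f : 'cV[R]_nt -> 'cV[R]_nx -> R)
  (g : 'cV[R]_nt -> 'cV[R]_nx -> 'cV[R]_nin)
  (h : 'cV[R]_nt -> 'cV[R]_nx -> 'cV[R]_neq) theta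
  (xs : 'cV[R]_nt -> 'cV[R]_nx) (ls : 'cV[R]_nt -> 'cV[R]_nin)
  (ns : 'cV[R]_nt -> 'cV[R]_neq) :
  regular f g h -> differentiable xs theta -> differentiable ls theta ->
  differentiable ns theta ->
  (\forall s \near theta, grad (lagrangian f g h s (ls s) (ns s)) (xs s) = 0) ->
  let x := xs theta in let lam := ls theta in let nu := ns theta in
  jac (fun s => grad (lagrangian f g h s lam nu) x) theta +
  hess (lagrangian f g h theta lam nu) x *m jac xs theta +
  (jac (g theta) x)^T *m jac ls theta + (jac (h theta) x)^T *m jac ns theta = 0.
Proof.
move=> [C1 [_ [[Cf Cg Ch] _]]] dxs dls dns stat x lam nu.
have gradE s y l n : grad (lagrangian f g h s l n) y =
    grad (f s) y + (jac (g s) y)^T *m l + (jac (h s) y)^T *m n.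
  have [Cfs Cgs Chs] := C1 s.
  apply: grad_lagrangian;
    [exact: (Cfs y _).1 | exact: (Cgs y _).1 | exact: (Chs y _).1].
have dsx : differentiable (fun s => (s, xs s)) theta.
  exact: differentiable_pair.
pose F p := grad (lagrangian f g h p.1 lam nu) p.2.
have dcst m (c : 'cV[R]_m) (U : normedModType R) (u : U) :
  differentiable (fun=> c) u by exact: differentiable_cst.
have df p i : differentiable (fun p => grad (f p.1) p.2 i 0) p.
  by apply: differentiable_entry; exact: (Cf p _).1.
have dg p i j : differentiable (fun p => jac (g p.1) p.2 i j) p.
  by apply: differentiable_entry; exact: (Cg p _).1.
have dh p i j : differentiable (fun p => jac (h p.1) p.2 i j) p.
  by apply: differentiable_entry; exact: (Ch p _).1.
have dF p i : differentiable (fun p => F p i 0) p.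
  have -> : (fun p => F p i 0) = (fun p => grad (f p.1) p.2 i 0) +
      (fun p => ((jac (g p.1) p.2)^T *m lam) i 0) +
      (fun p => ((jac (h p.1) p.2)^T *m nu) i 0).
    by apply/funext => q; rewrite /F gradE mxE [in LHS]mxE.
  apply: differentiableD; first apply: differentiableD => //.
  - exact: (differentiable_trmx_mulmx i (dg p) (dcst _ _ _ _)).
  - exact: (differentiable_trmx_mulmx i (dh p) (dcst _ _ _ _)).
have along (k : 'cV[R]_nt * 'cV[R]_nx -> R) : (forall p, differentiable k p) ->
    differentiable (fun s => k (s, xs s)) theta.
  by move=> dk; exact: (differentiable_comp dsx (dk _)).
have dfs i := along _ (df^~ i).
have dgs i j := along _ (fun p => dg p i j).
have dhs i j := along _ (fun p => dh p i j).
have := jac_along_curve (dF (theta, xs theta)) dxs.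
rewrite /F /= -/x -/lam -/nu => <-.
have -> : jac (fun s => grad (lagrangian f g h s lam nu) (xs s)) theta =
    jac (fun s => grad (f s) (xs s)) theta +
    jac (fun s => (jac (g s) (xs s))^T *m lam) theta +
    jac (fun s => (jac (h s) (xs s))^T *m nu) theta.
  rewrite -jacD//; last first.
    by move=> i; exact: (differentiable_trmx_mulmx i dgs (dcst _ _ _ _)).
  rewrite -jacD//; first by congr jac; apply/funext => s; rewrite gradE.
  - move=> i; rewrite (_ : (fun _ => _) = (fun s => grad (f s) (xs s) i 0) +
      (fun s => ((jac (g s) (xs s))^T *m lam) i 0)).
      apply: differentiableD; first exact: dfs.
      exact: (differentiable_trmx_mulmx i dgs (dcst _ _ _ _)).
    by apply/funext => s; rewrite mxE.
  - by move=> i; exact: (differentiable_trmx_mulmx i dhs (dcst _ _ _ _)).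
have -> : 0 = jac (fun s => grad (lagrangian f g h s (ls s) (ns s)) (xs s)) theta.
  rewrite -(jac_cst 0 theta); apply/row_matrixP => i; apply: near_eq_jac.
  by near=> s; rewrite (near stat s).
under [in RHS]eq_fun do rewrite gradE.
rewrite [RHS]jacD; last 2 first.
- move=> i; rewrite (_ : (fun _ => _) = (fun s => grad (f s) (xs s) i 0) +
    (fun s => ((jac (g s) (xs s))^T *m ls s) i 0)).
    apply: differentiableD; first exact: dfs.
    exact: (differentiable_trmx_mulmx i dgs dls).
  by apply/funext => s; rewrite mxE.
- by move=> i; exact: (differentiable_trmx_mulmx i dhs dns).
rewrite [in RHS]jacD//; last first.
  by move=> i; exact: (differentiable_trmx_mulmx i dgs dls).
rewrite (jac_trmx_mulmx dgs dls) (jac_trmx_mulmx dhs dns).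
by rewrite -!addrA; congr (_ + (_ + _)); rewrite addrCA.
Unshelve. all: by end_near. Qed.

(** Used for the derivative of the multipliers, whose inactive rows vanish. *)
Lemma trmx_mulmx_rows (R : realType) m n p (I : {set 'I_m})
    (M : 'M[R]_(m, n)) (N : 'M[R]_(m, p)) :
  (forall i, i \notin I -> row i N = 0) ->
  M^T *m N = (rows I M)^T *m rows I N.
Proof.
move=> N0; apply/matrixP => j k; rewrite !mxE.
rewrite (bigID (mem I)) /= [X in _ + X]big1 ?addr0 => [|i iI]; last first.
  have := congr1 (fun r : 'rV_ _ => r 0 k) (N0 i iI).
  by rewrite !mxE => ->; rewrite mulr0.
rewrite (eq_bigl (mem I))// big_enum_val; apply: eq_bigr => i _.
by rewrite !mxE.
Qed.

(** The remaining rows [W] of the solution are the derivatives of the active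
    inequality multipliers and of the equality multipliers. *)
Lemma solution_jac_system (R : realType) (nt nx nin neq : nat)
  (f : 'cV[R]_nt -> 'cV[R]_nx -> R)
  (g : 'cV[R]_nt -> 'cV[R]_nx -> 'cV[R]_nin)
  (h : 'cV[R]_nt -> 'cV[R]_nx -> 'cV[R]_neq) theta x lam nu
  (J : 'M[R]_(nx, nt)) :
  regular f g h -> feasible g h theta x -> SCS g theta x lam ->
  is_solution_jac f g h theta (x, lam, nu) J ->
  exists W, A_mx f g h theta x lam nu *m col_mx J W =
            - b_mx f g h theta x lam nu.
Proof.
move=> hreg [gle0 _] scs [N [phi [Nnbhs phiC1 phiPhi phit JE]]].
have nearN : \forall s \near theta, N s := open_nbhs_nbhs Nnbhs.
have dphi : differentiable phi theta.
  by apply: (phiC1 theta _).1; exact: nbhs_singleton.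
pose xs s := (phi s).1.1; pose ls s := (phi s).1.2; pose ns s := (phi s).2.
have xsE : xs theta = x by rewrite /xs phit.
have lsE : ls theta = lam by rewrite /ls phit.
have nsE : ns theta = nu by rewrite /ns phit.
have dxs : differentiable xs theta by do 2 apply: differentiable_fst_comp.
have dls : differentiable ls theta.
  by apply: differentiable_snd_comp; exact: differentiable_fst_comp.
have dns : differentiable ns theta by exact: differentiable_snd_comp.
have kkt s : N s -> [/\ grad (lagrangian f g h s (ls s) (ns s)) (xs s) = 0,
    h s (xs s) = 0 & forall i, ls s i 0 * g s (xs s) i 0 = 0].
  move=> /phiPhi; rewrite /Phi /= /xs /ls /ns; case: (phi s) => [[y l] n] /=.
  by case=> _ [-> [_ ->]].
have dsx : differentiable (fun s => (s, xs s)) theta.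
  exact: differentiable_pair.
have [_ [_ [_ [Cg Ch]]]] := hreg.
have dg p i : differentiable (fun p => g p.1 p.2 i 0) p.
  by apply: differentiable_entry; exact: (Cg p _).1.
have dh p i : differentiable (fun p => h p.1 p.2 i 0) p.
  by apply: differentiable_entry; exact: (Ch p _).1.
have g_cvg i : g s (xs s) i 0 @[s --> theta] --> g theta x i 0.
  rewrite -xsE; exact: (differentiable_continuous
    (differentiable_comp dsx (dg (theta, xs theta) i))).
have l_cvg i : ls s i 0 @[s --> theta] --> lam i 0.
  rewrite -lsE; exact: (differentiable_continuous (differentiable_entry i 0 dls)).
(* Complementarity determines one factor from the sign of the other. *)
have g_active i : i \in active g theta x ->
    \forall s \near theta, g s (xs s) i 0 = 0.
  move=> /scs li; have lpos := cvgr_gt _ (l_cvg i) _ li.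
  near=> s; have Ns : N s by near: s.
  have [_ _ /(_ i)/eqP] := kkt s Ns.
  have ls0 : 0 < ls s i 0 by near: s; exact: lpos.
  by rewrite mulf_eq0 gt_eqF//= => /eqP.
have l_inactive i : i \notin active g theta x ->
    \forall s \near theta, ls s i 0 = 0.
  rewrite inE => gi; have gneg : g theta x i 0 < 0 by rewrite lt_neqAle gi gle0.
  have gs := cvgr_lt _ (g_cvg i) _ gneg.
  near=> s; have Ns : N s by near: s.
  have [_ _ /(_ i)/eqP] := kkt s Ns.
  have gs0 : g s (xs s) i 0 < 0 by near: s; exact: gs.
  by rewrite mulf_eq0 orbC lt_eqF//= => /eqP.
have jls0 i : i \notin active g theta x -> row i (jac ls theta) = 0.
  move=> /l_inactive li; rewrite -[RHS](_ : row i (jac (fun=> 0) theta) = _).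
    by apply: near_eq_jac; near=> s; rewrite mxE; near: s; exact: li.
  by rewrite jac_cst row0.
have statE : \forall s \near theta,
    grad (lagrangian f g h s (ls s) (ns s)) (xs s) = 0.
  near=> s; have Ns : N s by near: s.
  by have [] := kkt s Ns.
have := jac_stationarity hreg dxs dls dns statE.
rewrite /= xsE lsE nsE (trmx_mulmx_rows _ jls0) => stat.
have gsys : rows (active g theta x) (jac (g^~ x) theta) +
    rows (active g theta x) (jac (g theta) x) *m J = 0.
  have := jac_along_curve (dg (theta, xs theta)) dxs; rewrite /= xsE => gE.
  apply/row_matrixP => k; rewrite row0.
  rewrite /rows mul_rowsub_mx -linearD /= JE -gE row_rowsub.
  rewrite -[RHS](_ : row (enum_val k) (jac (fun=> 0) theta) = _); last first.
    by rewrite jac_cst row0.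
  apply: near_eq_jac; near=> s; rewrite mxE.
  by near: s; apply: g_active; exact: enum_valP.
have hsys : jac (h^~ x) theta + jac (h theta) x *m J = 0.
  have := jac_along_curve (dh (theta, xs theta)) dxs; rewrite /= xsE => hE.
  apply/row_matrixP => k; rewrite JE -hE -(jac_cst 0 theta).
  apply: near_eq_jac; near=> s; have Ns : N s by near: s.
  by have [_ -> _] := kkt s Ns.
exists (col_mx (rows (active g theta x) (jac ls theta)) (jac ns theta)).
rewrite /A_mx /b_mx mul_block_col mul_row_col mul0mx addr0 mul_col_mx.
rewrite !opp_col_mx; congr (col_mx _ (col_mx _ _)).
- by apply/eqP; rewrite -addr_eq0 JE addrC !addrA; exact/eqP.
- by apply/eqP; rewrite -addr_eq0 addrC; exact/eqP.
- by apply/eqP; rewrite -addr_eq0 addrC; exact/eqP.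
Unshelve. all: by end_near. Qed.

(** * Invertibility and size of the perturbation *)

(** Let [(y, wg, wh)] be in the kernel. The last rows put [y] in the critical
    cone, and pairing the first row with [y] makes the quadratic form vanish at
    [y], so [y = 0] by SSOSC. The first row then is a linear relation between the
    active gradients, which is trivial by LICQ. *)
Lemma kkt_matrix_unit (R : realType) (nt nx nin neq : nat)
  (f : 'cV[R]_nt -> 'cV[R]_nx -> R)
  (g : 'cV[R]_nt -> 'cV[R]_nx -> 'cV[R]_nin)
  (h : 'cV[R]_nt -> 'cV[R]_nx -> 'cV[R]_neq) theta x lam nu :
  SSOSC f g h theta x lam nu -> LICQ g h theta x ->
  A_mx f g h theta x lam nu \in unitmx.
Proof.
move=> ssosc licq; apply: inj_unitmx => v.
rewrite -[v]vsubmxK; set y := usubmx v; set w := dsubmx v.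
rewrite -[w]vsubmxK /A_mx; set wg := usubmx w; set wh := dsubmx w.
rewrite mul_block_col mul_row_col mul0mx addr0 mul_col_mx.
set G := rows _ _; set H := jac _ _; set Q := hess _ _.
move=> /eqP; rewrite !col_mx_eq0.
move=> /andP[/eqP Qy /andP[/eqP Gy /eqP Hy]].
(* The hypothesis of SSOSC speaks of single rows of the Jacobian of [g]. *)
have Gy_row i : i \in active g theta x -> 0 < lam i 0 ->
    row i (jac (g theta) x) *m y = 0.
  move=> iI _; apply/rowP => j; rewrite ord1 mxE.
  have := congr1 (fun M : 'cV_ _ => M (enum_rank_in iI i) 0) Gy.
  rewrite !mxE => yi0.
  by rewrite -[RHS]yi0; apply: eq_bigr => l _; rewrite !mxE enum_rankK_in.
have y0 : y = 0.
  apply/eqP/negPn/negP => /ssosc/(_ Hy Gy_row).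
  rewrite -mulmxA (_ : _ *m y = - (G^T *m wg + H^T *m wh)); last first.
    by apply/eqP; rewrite -addr_eq0 Qy.
  rewrite mulmxN mulmxDr !mulmxA -!trmx_mul Gy Hy !trmx0 !mul0mx addr0 oppr0 mxE.
  by rewrite ltxx.
have w0 : w = 0.
  apply: trmx_inj; apply: (row_free_inj licq); rewrite trmx0 mul0mx.
  apply: trmx_inj; rewrite trmx0 trmx_mul trmxK tr_col_mx -[w]vsubmxK.
  by rewrite mul_row_col; move: Qy; rewrite y0 mulmx0 add0r.
by rewrite y0 vsubmxK w0 col_mx0.
Qed.

(** The sum of the [z_i ^- 2] serves as a constant dominating each of them. *)
Lemma norm_weight_mx_le (R : realType) (nt nx nin : nat)
  (g : 'cV[R]_nt -> 'cV[R]_nx -> 'cV[R]_nin) theta x (z : 'cV[R]_nin) :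
  (forall i, i \in inactive g theta x -> z i 0 != 0) ->
  exists2 K, 0 <= K & forall rho, 0 < rho ->
    `|weight_mx g theta x z rho| <= K * rho.
Proof.
move=> z0; set I := inactive g theta x.
have K0 : 0 <= \sum_(k < #|I|) (z (enum_val k) 0 ^+ 2)^-1.
  by apply: sumr_ge0 => k _; rewrite invr_ge0 sqr_ge0.
exists (\sum_(k < #|I|) (z (enum_val k) 0 ^+ 2)^-1) => // rho rho0.
apply/mx_norm_leP; first by rewrite mulr_ge0// ltW.
move=> i j; rewrite !mxE; case: eqP => _; last first.
  by rewrite mulr0n normr0 mulr_ge0// ltW.
have zi : 0 < z (enum_val i) 0 ^+ 2.
  by rewrite exprn_even_gt0//= z0// enum_valP.
rewrite mulr1n ger0_norm; last by rewrite divr_ge0 ?addr_ge0 ?sqr_ge0// ltW.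
rewrite mulrC ler_wpM2r ?(ltW rho0)// (bigD1 i)//=.
apply: (@le_trans _ _ (z (enum_val i) 0 ^+ 2)^-1).
  by rewrite lef_pV2 ?posrE ?ltr_wpDr ?sqr_ge0// lerDl sqr_ge0.
by rewrite lerDl sumr_ge0// => k _; rewrite invr_ge0 sqr_ge0.
Qed.

(** The three parts of the constant bound the two sandwiches around the weights
    and the two blocks [rho%:M] and [(- rho)%:M]. *)
Lemma surrogate_terms_bound (R : realType) (nt nx nin neq : nat)
  (g : 'cV[R]_nt -> 'cV[R]_nx -> 'cV[R]_nin) theta x (z : 'cV[R]_nin) :
  (forall i, i \in inactive g theta x -> z i 0 != 0) ->
  exists K, forall rho, 0 < rho ->
    `|B_mx (neq := neq) g theta x z rho| <= K * rho /\
    `|d_mx (neq := neq) g theta x z rho| <= K * rho.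
Proof.
move=> /norm_weight_mx_le[K K0 wK].
set n := #|inactive g theta x|.
set G := rows (inactive g theta x) (jac (g theta) x).
set T := rows (inactive g theta x) (jac (g^~ x) theta).
exists (n%:R ^+ 2 * `|G^T| * `|G| * K + n%:R ^+ 2 * `|G^T| * `|T| * K + 2).
move=> rho rho0.
have wbd p (Y : 'M[R]_(n, p)) : `|G^T *m weight_mx g theta x z rho *m Y| <=
    n%:R ^+ 2 * `|G^T| * `|Y| * K * rho.
  rewrite (le_trans (norm_sandwich_le _ _ _))// -[leRHS]mulrA.
  by rewrite ler_wpM2l ?wK ?mulr_ge0.
have [GG TT] := (wbd _ G, wbd _ T).
have ge0 p (Y : 'M[R]_(n, p)) : 0 <= n%:R ^+ 2 * `|G^T| * `|Y| * K * rho.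
  by rewrite !mulr_ge0// ltW.
have [GG0 TT0] := (ge0 _ G, ge0 _ T).
have diag q : `|rho%:M : 'M[R]_q| <= rho.
  by rewrite (le_trans (norm_scalar_mx_le _ _))// gtr0_norm.
have diagN q : `|(- rho)%:M : 'M[R]_q| <= rho.
  by rewrite (le_trans (norm_scalar_mx_le _ _))// normrN gtr0_norm.
rewrite !mulrDl; split.
  rewrite (le_trans (norm_block_mx_le _ _ _ _))// !normr0.
  have := ler_normD (G^T *m weight_mx g theta x z rho *m G) rho%:M.
  have := diag nx; have := diagN (#|active g theta x| + neq)%N.
  rewrite -/G; lra.
rewrite (le_trans (norm_col_mx_le _ _))// normr0 -/G -/T; lra.
Qed.

(** * Error of the surrogate derivative *)

Theorem theorem1 (R : realType) (nt nx nin neq : nat)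
  (f : 'cV[R]_nt -> 'cV[R]_nx -> R)
  (g : 'cV[R]_nt -> 'cV[R]_nx -> 'cV[R]_nin)
  (h : 'cV[R]_nt -> 'cV[R]_nx -> 'cV[R]_neq)
  (hreg : regular f g h)
  (theta : 'cV[R]_nt) (x : 'cV[R]_nx) (lam : 'cV[R]_nin) (nu : 'cV[R]_neq)
  (hPhi : Phi f g h theta (x, lam, nu))
  (hSSOSC : SSOSC f g h theta x lam nu)
  (hLICQ : LICQ g h theta x)
  (hSCS : SCS g theta x lam)
  (z : 'cV[R]_nin) (hXi : Xi f g h theta (x, z, (lam, nu)))
  (J : 'M[R]_(nx, nt)) (hJ : is_solution_jac f g h theta (x, lam, nu) J) :
  exists L : R, 0 < L /\
    \forall rho \near 0^'+, exists D : 'M[R]_(nx, nt),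
      is_surrogate_jac f g h theta x z lam nu rho D /\
      norm_inf (J - D) / norm_inf J <= L * rho.
Proof.
have [_ [_ xfeas _ _]] := hPhi.
have Aunit := kkt_matrix_unit hSSOSC hLICQ.
have [W AJW] := solution_jac_system hreg xfeas hSCS hJ.
have z_neq0 i : i \in inactive g theta x -> z i 0 != 0.
  rewrite !inE => gi; have [_ ->] := hXi.
  by rewrite sqrtr_eq0 -ltNge oppr_gt0 pmulr_rlt0// lt_neqAle gi xfeas.1.
have [K BdK] := surrogate_terms_bound neq z_neq0.
have Bnear : \forall rho \near 0^'+,
    `|B_mx (neq := neq) g theta x z rho| <= K * rho.
  by near=> rho; apply: (BdK rho _).1; near: rho; exact: nbhs_right_gt.
have dnear : \forall rho \near 0^'+,
    `|d_mx (neq := neq) g theta x z rho| <= K * rho.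
  by near=> rho; apply: (BdK rho _).2; near: rho; exact: nbhs_right_gt.
have [C C0 pert] := perturbed_system Aunit AJW Bnear dnear.
have /andP[J0 _] := norm_inf_bounds J.
(* Adding 1 keeps the constant positive when [C] or [J] is zero. *)
exists (nt%:R * C / norm_inf J + 1); split.
  by rewrite ltr_pwDr// !mulr_ge0// invr_ge0.
near=> rho.
have rho0 : 0 < rho by near: rho; exact: nbhs_right_gt.
have [ABunit close] : A_mx f g h theta x lam nu + B_mx g theta x z rho
      \in unitmx /\
    forall U, (A_mx f g h theta x lam nu + B_mx g theta x z rho) *m U =
      - (b_mx f g h theta x lam nu + d_mx g theta x z rho) ->
    `|col_mx J W - U| <= C * rho by near: rho; exact: pert.
set V := invmx (A_mx f g h theta x lam nu + B_mx g theta x z rho) *m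
  - (b_mx f g h theta x lam nu + d_mx g theta x z rho).
have VE : (A_mx f g h theta x lam nu + B_mx g theta x z rho) *m V =
    - (b_mx f g h theta x lam nu + d_mx g theta x z rho) by rewrite mulKVmx.
exists (usubmx V); split.
  exists V; split=> // U UE.
  by rewrite -(mulKmx ABunit U) UE.
have JV : J - usubmx V = usubmx (col_mx J W - V).
  by rewrite linearB /= col_mxKu.
have /andP[_ JVle] := norm_inf_bounds (J - usubmx V).
rewrite (@le_trans _ _ (nt%:R * C / norm_inf J * rho))//; last first.
  by rewrite ler_wpM2r ?(ltW rho0)// lerDl.
rewrite mulrAC ler_wpM2r ?invr_ge0// (le_trans JVle)// -mulrA ler_wpM2l//.
by rewrite JV (le_trans (norm_usubmx_le _))// close.
Unshelve. all: by end_near. Qed.
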